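(* Let $X$ be a standard Borel space with a probability measure $p$, and let $D:M\to\mathsf{PS(BorelStoch)}$ be a dynamical system acting on $(X,p)$, indexed by a monoid $M$ of arbitrary cardinality. Let $(X_{\mathrm{inv}},p_{\mathrm{inv}})$ be the set $X$ equipped with the almost surely invariant $\sigma$-algebra of $D$ and with the restriction of $p$ to it. Then $(X_{\mathrm{inv}},p_{\mathrm{inv}})$ is isomorphic in $\mathsf{PS(Stoch)}$ to a standard Borel probability space.
   Context: A Markov kernel $k:X\to Y$ between measurable spaces assigns to $x\in X$ and measurable $B\subseteq Y$ a number $k(B|x)\in[0,1]$, being a probability measure in $B$ and measurable in $x$; composition is $(h\circ k)(C|x)=\int_Y h(C|y)\,k(dy|x)$, and identities are $(B,x)\mapsto 1_B(x)$. For a probability measure $p$ on $X$, kernels $f,g:X\to Y$ are $p$-almost surely equal, $f\simeq_p g$, if $\int_A f(B|x)\,p(dx)=\int_A g(B|x)\,p(dx)$ for all measurable $A\subseteq X$, $B\subseteq Y$. The category $\mathsf{PS(Stoch)}$ has probability spaces $(X,p)$ as objects; morphisms $(X,p)\to(Y,q)$ are $p$-a.s. equality classes of Markov kernels $f:X\to Y$ with $q(B)=\int_X f(B|x)\,p(dx)$ for all measurable $B$. $\mathsf{PS(BorelStoch)}$ is its full subcategory on standard Borel probability spaces. A dynamical system $D:M\to\mathsf{PS(BorelStoch)}$ acting on $(X,p)$ is a functor from the monoid $M$ (as a one-object category) sending the single object to $(X,p)$; the morphism $(X,p)\to(X,p)$ induced by $m\in M$ is again denoted $m$. A measurable subset $A\subseteq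 X$ is (almost surely) invariant if for every $m\in M$, $m(A|x)=1_A(x)$ for $p$-almost all $x$, i.e. $\int_B m(A|x)\,p(dx)=p(A\cap B)$ for every measurable $B\subseteq X$. Such sets form the almost surely invariant $\sigma$-algebra. *)

(* Defs.v *)
From HB Require Import structures.
From mathcomp Require Import all_boot all_order all_algebra.
From mathcomp Require Import all_classical all_reals all_analysis.
From mathcomp Require Import measurable_realfun lebesgue_integral.

Set Implicit Arguments.
Unset Strict Implicit.
Unset Printing Implicit Defensive.

Import Order.TTheory GRing.Theory Num.Theory.
Import numFieldNormedType.Exports.

Local Open Scope classical_set_scope.
Local Open Scope ring_scope.
Local Open Scope ereal_scope.
Local Open Scope quotient_scope.

(* A complete separable metric space. *)
Definition polish (R : realType) (T : metricType R) : Prop :=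
  (forall F : set_system T, ProperFilter F -> cauchy F ->
     exists l : T, F --> l) /\
  (exists2 S : set T, countable S & dense S).

(* X is isomorphic, as a measurable space, to a Polish space T with its Borel
   sigma-algebra. As f is bijective, the last clause says that f and its
   inverse are both measurable. *)
Definition standard_borel (R : realType) (d : measure_display)
    (X : measurableType d) : Prop :=
  exists (T : metricType R) (f : X -> T),
    [/\ polish T, bijective f &
        forall B : set T, measurable (f @^-1` B) <-> <<s [set U | open U] >> B].

Section probability_kernels.
Context {d d' d'' : measure_display} {X : measurableType d}
  {Y : measurableType d'} {Z : measurableType d''} {R : realType}.
Variables (h : R.-pker Y ~> Z) (k : R.-pker X ~> Y).

Let mkcomp_noparam_prob x : mkcomp_noparam k h x [set: Z] = 1.
Proof.
rewrite /mkcomp_noparam /= /kcomp_noparam.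
under eq_integral do rewrite prob_kernel.
by rewrite integral_cst// mul1e prob_kernel.
Qed.

HB.instance Definition _ :=
  isProbabilityKernel.Build _ _ _ _ _ (mkcomp_noparam k h) mkcomp_noparam_prob.

(* h \o k *)
Definition kernel_comp : R.-pker X ~> Z := mkcomp_noparam k h.

Lemma kernel_compE x C : kernel_comp x C = \int[k x]_y h y C.
Proof. by []. Qed.

End probability_kernels.

Definition kernel_id {d : measure_display} {X : measurableType d}
  {R : realType} : R.-pker X ~> X := kdirac (@measurable_id _ X setT).

Section as_equality.
Context {d d' : measure_display} {X : measurableType d} {Y : measurableType d'}
  {R : realType}.

Definition as_eq (p : probability X R) (f g : R.-pker X ~> Y) : Prop :=
  forall (A : set X) (B : set Y), measurable A -> measurable B ->
    \int[p]_(x in A) f x B = \int[p]_(x in A) g x B.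

Definition preserves (p : probability X R) (q : probability Y R)
    (f : R.-pker X ~> Y) : Prop :=
  forall B : set Y, measurable B -> q B = \int[p]_x f x B.

Lemma as_eq_refl (p : probability X R) (f : R.-pker X ~> Y) : as_eq p f f.
Proof. by []. Qed.

Lemma as_eq_sym (p : probability X R) (f g : R.-pker X ~> Y) :
  as_eq p f g -> as_eq p g f.
Proof. by move=> fg A B mA mB; rewrite fg. Qed.

Lemma as_eq_trans (p : probability X R) (f g h : R.-pker X ~> Y) :
  as_eq p f g -> as_eq p g h -> as_eq p f h.
Proof. by move=> fg gh A B mA mB; rewrite fg// gh. Qed.

Lemma measurable_pker (f : R.-pker X ~> Y) (A : set X) (B : set Y) :
  measurable A -> measurable B -> measurable_fun A (f ^~ B).
Proof. by move=> mA mB; exact: (measurable_funTS (measurable_kernel f B mB)). Qed.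

Lemma integrable_pker (p : probability X R) (f : R.-pker X ~> Y) (B : set Y) :
  measurable B -> p.-integrable setT (f ^~ B).
Proof.
move=> mB; have := finite_measure_integrable_cst p 1%R measurableT.
apply: le_integrable => //; first exact: measurable_pker.
move=> x _ /=; rewrite normr1 gee0_abs// -(prob_kernel (s := f) x).
by rewrite le_measure ?inE.
Qed.

Lemma pker_setC (f : R.-pker X ~> Y) x (B : set Y) :
  measurable B -> f x (~` B) = 1 - f x B.
Proof.
move=> mB; have fx1 : f x setT = 1 by exact: prob_kernel.
have mu : f x setT < +oo by rewrite fx1 ltry.
by rewrite -setTD (@measureD _ _ _ (f x) _ _ measurableT mB mu) setTI -fx1.
Qed.

Lemma as_eqP (p : probability X R) (f g : R.-pker X ~> Y) :
  as_eq p f g <->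
  forall B, measurable B -> {ae p, forall x, f x B = g x B}.
Proof.
split=> [fg B mB|fg A B mA mB].
  have : ae_eq p setT (f ^~ B) (g ^~ B).
    apply: integral_ae_eq => //; [exact: integrable_pker|exact: measurable_pker|].
    by move=> E _ mE; exact: fg.
  by apply: filterS => x /(_ Logic.I).
apply: ge0_ae_eq_integral => //; try exact: measurable_pker.
by apply: filterS (fg B mB) => x.
Qed.

End as_equality.

Section integral_disintegration.
Context {d d' : measure_display} {X : measurableType d} {Y : measurableType d'}
  {R : realType}.
Variables (p : probability X R) (f : R.-pker X ~> Y) (A : set X).
Hypothesis mA : measurable A.

Let pA : {measure set X -> \bar R} := mrestr p mA.
Let l (_ : unit) : {measure set X -> \bar R} := pA.

Let ml (U : set X) : measurable U -> measurable_fun [set: unit] (l ^~ U).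
Proof. by move=> mU; exact: measurable_cst. Qed.

HB.instance Definition _ := isKernel.Build _ _ _ _ R l ml.

Let l_uub : measure_fam_uub l.
Proof.
exists 2%R => /= _; rewrite /l/pA/= /mrestr setTI.
by rewrite (le_lt_trans (probability_le1 p mA))// lte1n.
Qed.

HB.instance Definition _ := Kernel_isFinite.Build _ _ _ _ R l l_uub.

Let f2 : R.-spker (unit * X)%type ~> Y := kernel.kernel_snd f.

Let integral_pA (v : X -> \bar R) : (forall x, 0 <= v x) ->
  measurable_fun setT v -> \int[pA]_x v x = \int[p]_(x in A) v x.
Proof.
move=> v0 mv.
rewrite (@ge0_negligible_integral _ _ _ pA setT (~` A))//; last 2 first.
- exact: measurableC.
- by rewrite /pA/= /mrestr setICl measure0.
rewrite setTD setCK; apply: eq_measure_integral => B mB BA.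
by rewrite /pA/= /mrestr setIidl.
Qed.

Lemma integral_disintegration : exists mu : {measure set Y -> \bar R},
  (forall B, measurable B -> mu B = \int[p]_(x in A) f x B) /\
  (forall u : Y -> \bar R, (forall y, 0 <= u y) -> measurable_fun setT u ->
    \int[mu]_y u y = \int[p]_(x in A) \int[f x]_y u y).
Proof.
exists (mkcomp l f2 tt); split => [B mB|u u0 mu].
  rewrite /mkcomp/= /kcomp integral_pA//; exact: measurable_kernel.
rewrite [LHS]integral_kcomp// integral_pA//.
  by move=> x; exact: integral_ge0.
apply: measurable_fun_integral_kernel => // U mU; exact: measurable_kernel.
Qed.

End integral_disintegration.

Section category.
Context {d d' d'' : measure_display} {X : measurableType d}
  {Y : measurableType d'} {Z : measurableType d''} {R : realType}.
Variables (p : probability X R) (q : probability Y R) (r : probability Z R).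

Lemma preserves_comp (h : R.-pker Y ~> Z) (f : R.-pker X ~> Y) :
  preserves p q f -> preserves q r h -> preserves p r (kernel_comp h f).
Proof.
move=> pf ph C mC; rewrite ph//.
have [mu [muE muI]] := integral_disintegration p f measurableT.
rewrite (eq_measure_integral mu); last first.
  by move=> B mB _; rewrite [RHS]muE//; exact: pf.
by rewrite muI//; exact: measurable_kernel.
Qed.

Lemma as_eq_comp (h h' : R.-pker Y ~> Z) (f f' : R.-pker X ~> Y) :
  preserves p q f -> as_eq q h h' -> as_eq p f f' ->
  as_eq p (kernel_comp h f) (kernel_comp h' f').
Proof.
move=> pf hh' ff'; apply: (@as_eq_trans _ _ _ _ _ _ _ (kernel_comp h' f)).
- apply/as_eqP => C mC.
  have [N [mN qN hN]] := (as_eqP q h h').1 hh' C mC.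
  have : {ae p, forall x, f x N = 0}.
    have : ae_eq p setT (f ^~ N) (cst 0).
      apply/ae_eq_integral_abs => //; first exact: measurable_kernel.
      under eq_integral do rewrite gee0_abs//.
      by rewrite -pf.
    by apply: filterS => x /(_ Logic.I).
  apply: filterS => x fN; rewrite !kernel_compE.
  apply: ge0_ae_eq_integral => //; try exact: measurable_pker.
  by exists N; split=> // y /= ny; apply: hN => /= e; apply: ny.
- move=> A C mA mC.
  have [mu [muE muI]] := integral_disintegration p f mA.
  have [mu' [muE' muI']] := integral_disintegration p f' mA.
  have mh : measurable_fun setT (h' ^~ C) by exact: measurable_kernel.
  transitivity (\int[mu]_y h' y C); first by rewrite muI.
  transitivity (\int[mu']_y h' y C); last by rewrite muI'.
  by apply: eq_measure_integral => B mB _; rewrite muE// muE'// ff'.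
Qed.

End category.

Lemma preserves_id (d : measure_display) (X : measurableType d) (R : realType)
  (p : probability X R) : preserves p p kernel_id.
Proof.
move=> B mB; rewrite (eq_integral (fun x => (\1_B x)%:E)).
  by rewrite integral_indic// setIT.
by move=> x _; rewrite /kernel_id/= /kdirac/= diracE.
Qed.

Section morphisms.
Context {d d' : measure_display} {X : measurableType d} {Y : measurableType d'}
  {R : realType}.
Variables (p : probability X R) (q : probability Y R).

Record preserving_kernel := PreservingKernel {
  pkernel :> R.-pker X ~> Y ;
  pkernelP : preserves p q pkernel }.

HB.instance Definition _ := gen_eqMixin preserving_kernel.
HB.instance Definition _ := gen_choiceMixin preserving_kernel.

Definition as_eqb (f g : preserving_kernel) : bool := `[< as_eq p f g >].

Let as_eqb_refl : reflexive as_eqb.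
Proof. by move=> f; apply/asboolP; exact: as_eq_refl. Qed.

Let as_eqb_sym : symmetric as_eqb.
Proof.
by move=> f g; apply/idP/idP => /asboolP fg; apply/asboolP; exact: as_eq_sym.
Qed.

Let as_eqb_trans : transitive as_eqb.
Proof.
move=> g f h /asboolP fg /asboolP gh; apply/asboolP; exact: as_eq_trans fg gh.
Qed.

Canonical as_eqb_equiv := EquivRel as_eqb as_eqb_refl as_eqb_sym as_eqb_trans.

(* The morphisms (X, p) -> (Y, q) of PS(Stoch). *)
Definition PShom : Type := {eq_quot as_eqb}.
HB.instance Definition _ := Choice.on PShom.
HB.instance Definition _ := EqQuotient.on PShom.

Lemma PShom_eqP (f g : preserving_kernel) :
  \pi_PShom f = \pi_PShom g <-> as_eq p f g.
Proof.
split=> [/eqP|fg]; first by rewrite eqmodE => /asboolP.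
by apply/eqP; rewrite eqmodE; apply/asboolP.
Qed.

End morphisms.
Arguments PreservingKernel {d d' X Y R p q}.

Definition PSid {d : measure_display} {X : measurableType d} {R : realType}
  (p : probability X R) : PShom p p :=
  \pi_(PShom p p) (PreservingKernel kernel_id (preserves_id p)).

Section composition.
Context {d d' d'' : measure_display} {X : measurableType d}
  {Y : measurableType d'} {Z : measurableType d''} {R : realType}.
Context {p : probability X R} {q : probability Y R} {r : probability Z R}.

Definition pkernel_comp (h : preserving_kernel q r) (f : preserving_kernel p q)
    : preserving_kernel p r :=
  PreservingKernel (kernel_comp h f)
    (preserves_comp (@pkernelP _ _ _ _ _ _ _ f) (@pkernelP _ _ _ _ _ _ _ h)).

(* PScomp h f is "h after f"; by PScomp_pi it does not depend on the chosen
   representatives. *)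
Definition PScomp (h : PShom q r) (f : PShom p q) : PShom p r :=
  \pi_(PShom p r) (pkernel_comp (repr h) (repr f)).

Lemma PScomp_pi (h : preserving_kernel q r) (f : preserving_kernel p q) :
  PScomp (\pi_(PShom q r) h) (\pi_(PShom p q) f) =
  \pi_(PShom p r) (pkernel_comp h f).
Proof.
apply/PShom_eqP; apply: (as_eq_comp (q := q)).
- exact: pkernelP.
- by apply/PShom_eqP; rewrite reprK.
- by apply/PShom_eqP; rewrite reprK.
Qed.

End composition.

Definition PSisomorphic {d d' : measure_display} {X : measurableType d}
    {Y : measurableType d'} {R : realType} (p : probability X R)
    (q : probability Y R) : Prop :=
  exists (f : PShom p q) (g : PShom q p),
    PScomp g f = PSid p /\ PScomp f g = PSid q.

(* A functor from the one-object category M to PS(Stoch) with value (X, p). *)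
Record dynamical_system (M : monoidType) (d : measure_display)
    (X : measurableType d) (R : realType) (p : probability X R) :=
  DynamicalSystem {
    action :> M -> PShom p p ;
    action1 : action 1%g = PSid p ;
    actionM : forall m n : M, action (m * n)%g = PScomp (action m) (action n) }.

Section invariant_sigma_algebra.
Context {M : monoidType} {d : measure_display} {X : measurableType d}
  {R : realType} {p : probability X R}.
Variable D : dynamical_system M p.

Definition as_invariant : set (set X) :=
  [set A | measurable A /\
    forall m : M, {ae p, forall x, repr (D m) x A = (\1_A x)%:E}].

Lemma as_invariantP (A : set X) : measurable A ->
  as_invariant A <->
  forall (m : M) (f : preserving_kernel p p), \pi_(PShom p p) f = D m ->
    forall B, measurable B -> \int[p]_(x in B) f x A = p (A `&` B).
Proof.
move=> mA; have mI : measurable_fun setT (fun x => (\1_A x)%:E : \bar R).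
  exact/measurable_EFinP.
split=> [[_ iA] m f fD B mB|iA].
- have /PShom_eqP : \pi_(PShom p p) f = \pi_(PShom p p) (repr (D m)).
    by rewrite reprK.
  move=> ->//; transitivity (\int[p]_(x in B) (\1_A x)%:E).
    apply: ge0_ae_eq_integral; [by []| | | | |].
    + exact: measurable_pker.
    + exact: measurable_funTS.
    + by move=> x _; exact: measure_ge0.
    + by move=> x _; rewrite lee_fin.
    + by apply: filterS (iA m) => x.
  by rewrite integral_indic.
- split=> // m.
  have : ae_eq p setT (repr (D m) ^~ A) (fun x => (\1_A x)%:E).
    apply: integral_ae_eq => //; first exact: integrable_pker.
    by move=> E _ mE; rewrite (iA m)// ?reprK// integral_indic.
  by apply: filterS => x /(_ Logic.I).
Qed.

Lemma as_invariant0 : as_invariant set0.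
Proof. by split=> // m; apply: aeW => x; rewrite measure0 indicE in_set0. Qed.

Lemma as_invariantC (A : set X) : as_invariant A -> as_invariant (~` A).
Proof.
move=> [mA iA]; split=> [|m]; first exact: measurableC.
apply: filterS (iA m) => x ixA.
rewrite pker_setC// ixA !indicE in_setC.
by case: (x \in A) => /=; rewrite ?subee// sube0.
Qed.

Lemma as_invariant_bigcup (F : (set X)^nat) :
  (forall n, as_invariant (F n)) -> as_invariant (\bigcup_n F n).
Proof.
move=> iF; split=> [|m]; first by apply: bigcupT_measurable => n; case: (iF n).
have : {ae p, forall x, forall n, repr (D m) x (F n) = (\1_(F n) x)%:E}.
  by apply/ae_foralln => n; case: (iF n).
apply: filterS => x xF.
have mF n : measurable (F n) by case: (iF n).
have mUF : measurable (\bigcup_n F n) by exact: bigcupT_measurable.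
rewrite indicE; have [|nx] := boolP (x \in _).
  rewrite inE => -[n _ Fnx]; apply/eqP; rewrite eq_le; apply/andP; split.
    have <- : repr (D m) x setT = 1 by exact: prob_kernel.
    by rewrite le_measure ?inE.
  have -> : 1%:R%:E = repr (D m) x (F n) by rewrite xF indicE mem_set.
  by rewrite le_measure ?inE//; exact: bigcup_sup.
apply/eqP; rewrite eq_le measure_ge0 andbT.
have := @measure_sigma_subadditive _ _ _ (repr (D m) x)
  _ _ mF mUF (@subset_refl _ _).
move=> /le_trans; apply.
rewrite eseries0// => n _ _; rewrite xF indicE memNset// => Fnx.
by move: nx; rewrite notin_setE; apply; exists n.
Qed.

End invariant_sigma_algebra.
Arguments as_invariant {M d X R p} D _.

(* X with the almost surely invariant sigma-algebra. *)
Definition X_inv {M : monoidType} {d : measure_display} {X : measurableType d}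
  {R : realType} {p : probability X R} (D : dynamical_system M p) : Type := X.

Section invariant_probability_space.
Context {M : monoidType} {d : measure_display} {X : measurableType d}
  {R : realType} {p : probability X R}.
Variable D : dynamical_system M p.

HB.instance Definition _ := Pointed.on (X_inv D).
HB.instance Definition _ := @isMeasurable.Build
  (sigma_display (as_invariant D)) (X_inv D) (as_invariant D)
  (as_invariant0 D) (@as_invariantC _ _ _ _ _ D)
  (@as_invariant_bigcup _ _ _ _ _ D).

Lemma measurable_X_invE (A : set (X_inv D)) : measurable A = as_invariant D A.
Proof. by []. Qed.

Lemma X_inv_sub_measurable (A : set (X_inv D)) :
  measurable A -> measurable (A : set X).
Proof. by rewrite measurable_X_invE => -[]. Qed.

(* The restriction of p to the almost surely invariant sigma-algebra. *)
Definition p_inv : set (X_inv D) -> \bar R := p.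

Let p_inv0 : p_inv set0 = 0. Proof. exact: measure0. Qed.

Let p_inv_ge0 A : 0 <= p_inv A. Proof. exact: measure_ge0. Qed.

Let p_inv_sigma_additive : semi_sigma_additive p_inv.
Proof.
move=> F mF tF mUF; apply: (@measure_semi_sigma_additive _ _ _ p) => //.
- by move=> n; exact: X_inv_sub_measurable.
- exact: X_inv_sub_measurable.
Qed.

HB.instance Definition _ :=
  isMeasure.Build _ _ _ p_inv p_inv0 p_inv_ge0 p_inv_sigma_additive.

Let p_invT : p_inv setT = 1. Proof. exact: probability_setT. Qed.

HB.instance Definition _ := Measure_isProbability.Build _ _ _ p_inv p_invT.

End invariant_probability_space.
Arguments p_inv {M d X R p} D _.

(* Main.v *)
(* Forgetting the full sigma-algebra makes (X_inv, p_inv) a measurable quotient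
   pi : (X, p) -> (W, w) of a standard Borel probability space; any such
   quotient is isomorphic in PS(Stoch) to a probability measure on the real
   line. Code X by a real variable Z with a measurable left inverse r. The
   conditional law of Z given W is determined by the conditional probabilities
   of the events {Z <= t}, t rational, hence by countably many measurable
   subsets of W, and these are coded by a single measurable phi : W -> R. So the
   conditional law of Z at x is k (phi x) for a kernel k : R -> R. Let q be the
   law of phi, and let g be k pushed forward along pi \o r. Then
   g (phi x) B is the conditional probability of B given W, which is the
   indicator of B almost surely, for every measurable subset B of W: this single
   identity says that phi and g are mutually inverse. *)

Require Import Defs.
From HB Require Import structures.
From mathcomp Require Import all_boot all_order all_algebra.
From mathcomp Require Import all_classical all_reals all_analysis.
From mathcomp Require Import measurable_realfun lebesgue_integral.
From mathcomp Require Import ring lra.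

Set Implicit Arguments.
Unset Strict Implicit.
Unset Printing Implicit Defensive.

Import Order.TTheory GRing.Theory Num.Theory.
Import numFieldNormedType.Exports.

Local Open Scope classical_set_scope.
Local Open Scope ring_scope.

(** * Ternary expansions and Marczewski functions *)

(* Only the digits 0 and 2 are used, so comparing a tail with 1/2 reads off its
   first digit. *)
Section ternary_expansion.
Context {R : realType}.
Variable b : nat -> bool.

Let S (n : nat) : R := \sum_(i < n) (b i)%:R * 2 / 3 ^+ i.+1.

Let pow3_gt0 n : 0 < 3 ^+ n :> R.
Proof. by rewrite exprn_gt0. Qed.

Let S_nd : nondecreasing_seq S.
Proof.
apply/nondecreasing_seqP => n; rewrite /S big_ord_recr/= lerDl.
by rewrite !mulr_ge0// invr_ge0 ltW.
Qed.

(** Digit n adds at most 2 / 3^(n+1), exactly what the second term loses from n to n+1. With [S_nd]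
    this squeezes the limit between [S n] and [S n] + 3^-n. *)
Let U_ni : nonincreasing_seq (fun n => S n + (3 ^+ n)^-1).
Proof.
apply/nonincreasing_seqP => n; rewrite /S big_ord_recr/= -addrA lerD2l.
rewrite exprS invfM; have : 0 < (3 ^+ n : R)^-1 by rewrite invr_gt0.
by case: (b n) => /=; lra.
Qed.

Let S_leU n m : S n <= S m + (3 ^+ m)^-1.
Proof.
have [nm|/ltnW mn] := leqP n m.
  by rewrite (le_trans (S_nd nm))// lerDl invr_ge0 ltW.
by rewrite (le_trans _ (U_ni mn))// lerDl invr_ge0 ltW.
Qed.

Let S_cvg : cvgn S.
Proof.
apply: (nondecreasing_is_cvgn S_nd); exists (S 0 + (3 ^+ 0)^-1) => _ [n _ <-].
exact: S_leU.
Qed.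

Definition ternary : R := limn S.

(** The expansion of t shifted by n digits. Each digit is recovered from t by a comparison instead
    of being taken from [b], so the tail is a measurable function of a real variable. *)
Fixpoint ternary_tail (t : R) (n : nat) : R :=
  if n is m.+1 then
    3 * ternary_tail t m - 2 * (2^-1 < ternary_tail t m)%R%:R
  else t.

Lemma ternary_cvg :
  (fun n => \sum_(i < n) (b i)%:R * 2 / 3 ^+ i.+1) @ \oo --> ternary.
Proof. exact: S_cvg. Qed.

Let ternary_bound n : S n <= ternary <= S n + (3 ^+ n)^-1.
Proof.
rewrite nondecreasing_cvgn_le//=.
by apply: limr_le => //; apply: nearW => m; exact: S_leU.
Qed.

Lemma ternary_ge0_le1 : 0 <= ternary <= 1.
Proof. by have := ternary_bound 0; rewrite /S big_ord0 expr0 invr1 add0r. Qed.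

Lemma ternary_tailK n : (2^-1 < ternary_tail ternary n) = b n.
Proof.
(* Scaled by 3^m, the bounds at m+1 put the tail in [0, 1/3] if digit m is 0 and in [2/3, 1] if it
   is 2. *)
have digit m : ternary_tail ternary m = 3 ^+ m * (ternary - S m) ->
    (2^-1 < ternary_tail ternary m) = b m.
  move=> ->; have := ternary_bound m.+1.
  rewrite {1 2}/S big_ord_recr/= -/(S m) exprS invfM.
  have : 3 ^+ m * (3 ^+ m)^-1 = 1 :> R by rewrite mulfV// gt_eqF.
  have := pow3_gt0 m; set c := 3 ^+ m; set e := _^-1 => c0 ce.
  have e0 : 0 < e by rewrite invr_gt0.
  move=> /andP[l u].
  have := ler_wpM2l (ltW c0) l; have := ler_wpM2l (ltW c0) u.
  have -> : c * (S m + (b m)%:R * 2 * (3^-1 * e) + 3^-1 * e) =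
    c * S m + ((b m)%:R * 2 + 1) * 3^-1 * (c * e) by ring.
  have -> : c * (S m + (b m)%:R * 2 * (3^-1 * e)) =
    c * S m + (b m)%:R * 2 * 3^-1 * (c * e) by ring.
  rewrite ce mulrBr; case: (b m) => /= h1 h2; first by lra.
  by apply/negbTE; rewrite -leNgt; lra.
apply: (digit _); elim: n => [|n ih]; first by rewrite /S big_ord0 subr0 mul1r.
rewrite /= (digit _ ih) ih /S big_ord_recr/= -/(S n) exprS.
by field; rewrite gt_eqF.
Qed.

End ternary_expansion.

Lemma measurable_ternary_tail {R : realType} n :
  measurable_fun setT (fun t : R => ternary_tail t n).
Proof.
elim: n => [|n ih] //=; apply: measurable_funB.
  exact: measurable_funM.
apply: measurable_funM => //.
have -> : (fun t : R => (2^-1 < ternary_tail t n)%R%:R : R) =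
    \1_[set t | 2^-1 < ternary_tail t n].
  by apply/funext => t; rewrite indicE mem_setE.
apply: measurable_indic.
have := ih measurableT _ (measurable_itv `]2^-1, +oo[); rewrite setTI.
by congr measurable; apply/seteqP; split => t /=; rewrite in_itv/= andbT.
Qed.

(** The digits of [phi w] record the memberships of w in the sets [C n], and [E n] reads digit n off
    a real number. As a limit of finite sums of indicators, [phi] is measurable. *)
Lemma marczewski_seq (R : realType) d (W : measurableType d)
    (C : (set W)^nat) : (forall n, measurable (C n)) ->
  exists (phi : W -> R) (E : (set R)^nat),
    [/\ measurable_fun setT phi, forall w, 0 <= phi w <= 1,
        forall n, measurable (E n) & forall n, phi @^-1` E n = C n].
Proof.
move=> mC.
exists (fun w => ternary (fun n => w \in C n)).
exists (fun n => [set t | (2^-1 : R) < ternary_tail t n]).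
split=> [|w|n|n].
- apply: (measurable_fun_cvg (h := fun n w =>
    \sum_(i < n) ((w \in C i)%:R * 2 / 3 ^+ i.+1))) => [n|w _].
    apply: measurable_sum => i; apply: measurable_funM => //.
    apply: measurable_funM => //.
    have -> : (fun w => (w \in C i)%:R : R) = \1_(C i) by apply/funext.
    exact: measurable_indic.
  exact: ternary_cvg.
- exact: ternary_ge0_le1.
- have := @measurable_ternary_tail R n measurableT _
    (measurable_itv `]2^-1, +oo[).
  rewrite setTI.
  by congr measurable; apply/seteqP; split => t /=; rewrite in_itv/= andbT.
- by apply/seteqP; split=> w /=; rewrite ternary_tailK inE.
Qed.

(* Known as the Marczewski function of the family [C]. *)
Lemma marczewski_function (R : realType) d (W : measurableType d)
    (I : countType) (C : I -> set W) : (forall i, measurable (C i)) ->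
  exists (phi : W -> R) (E : I -> set R),
    [/\ measurable_fun setT phi, forall w, 0 <= phi w <= 1,
        forall i, measurable (E i) & forall i, phi @^-1` E i = C i].
Proof.
move=> mC; have [|phi [E [mphi phi01 mE phiE]]] := @marczewski_seq R _ _
  (fun n => if unpickle n is Some i then C i else set0).
  by move=> n; case: unpickle.
exists phi, (fun i => E (pickle i)); split=> // i.
by rewrite phiE pickleK.
Qed.

(** * Coding standard Borel spaces by reals *)

(** The pieces [seqDU E k] are disjoint, so t lies in at most one of them, the one of its least
    index. The value 0 is taken when there is none. *)
Lemma measurable_first_index d (T : measurableType d) (E : (set T)^nat) :
  (forall k, measurable (E k)) ->
  exists2 a : T -> nat, measurable_fun setT a &
    forall t, (exists k, E k t) -> E (a t) t.
Proof.
move=> mE; have mF k : measurable (seqDU E k).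
  by apply: measurableD => //; exact: bigsetU_measurable.
exists (fun t => xget 0%N [set k | seqDU E k t]).
  move=> _ B _; rewrite setTI -[B]image_id -bigcup_imset1 preimage_bigcup.
  apply: bigcup_measurable => -[|k] _.
    (* Since 0 is also the default value, its preimage is what the pieces of positive index leave
       over. *)
    have -> : (fun t => xget 0%N [set k | seqDU E k t]) @^-1` [set 0%N] =
        ~` (\bigcup_k seqDU E k.+1).
      apply/seteqP; split=> t /=.
        case: xgetP => [i ->|nE _]; last by move=> [k _ Ek]; exact: (nE k.+1).
        move=> + i0; rewrite i0/= => E0 [k _ Ek].
        by have /(_ (ex_intro _ t (conj E0 Ek))) :=
          @trivIset_seqDU _ E 0%N k.+1 Logic.I Logic.I.
      move=> nE; case: xgetP => // -[|k] //= _ Ek.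
      by exfalso; apply: nE; exists k.
    by apply: measurableC; exact: bigcupT_measurable.
  rewrite (_ : _ @^-1` _ = seqDU E k.+1)//; apply/seteqP; split=> t /=.
    by case: xgetP => // i -> + ik; rewrite ik.
  move=> Ek; apply: xget_subset1 => // i j /= Ei Ej.
  by apply: (@trivIset_seqDU _ E) => //; exists t.
move=> t [k Ekt]; have [i _ Fi] : (\bigcup_k seqDU E k) t.
  by rewrite -seqDU_bigcup_eq; exists k.
have : [set k | seqDU E k t] (xget 0%N [set k | seqDU E k t]).
  by apply: xgetPex; exists i.
by move=> [].
Qed.

Lemma measurable_fun_nat2 d (T : measurableType d) (u v : T -> nat)
    (F : nat -> nat -> nat) :
  measurable_fun setT u -> measurable_fun setT v ->
  measurable_fun setT (fun t => F (u t) (v t)).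
Proof.
move=> mu mv _ B _; rewrite setTI.
rewrite (_ : _ @^-1` _ = \bigcup_i (u @^-1` [set i] `&` v @^-1` (F i @^-1` B))).
  apply: bigcupT_measurable => i; apply: measurableI.
    by rewrite -[X in measurable X]setTI; exact: mu.
  by rewrite -[X in measurable X]setTI; exact: mv.
by apply/seteqP; split=> [t Bt|t [i _ [<-]]]//; exists (u t).
Qed.

Lemma polish_dense_sequence (R : realType) (T : metricType R) : polish T ->
  T -> exists e : nat -> T, forall t (eps : R), 0 < eps ->
    exists k, mdist t (e k) < eps.
Proof.
move=> [_ [S /countable_injP[h hinj] dS]] t0.
(* An injection numbers the dense set; numbers that belong to no point are sent to [t0]. *)
exists (fun k => xget t0 [set s | S s /\ h s = k]) => t eps eps0.
have [||s [ts Ss]] := dS (ball t eps)^°; last 1 first.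
- exists (h s); case: xgetP => [x _ [Sx hx]|/(_ s)[]//].
  rewrite (hinj x s) ?inE//; have := interior_subset ts.
  by rewrite ballEmdist.
- by exists t; exact: nbhsx_ballx.
- exact: open_interior.
Qed.

Lemma exists_half_expn_lt (R : realType) (eps : R) : 0 < eps ->
  exists n, (2 ^+ n)^-1 < eps.
Proof.
move=> eps0; have [n _ /(_ n)/=] := near_infty_natSinv_expn_lt (PosNum eps0).
by rewrite div1r leqnn => /(_ isT); exists n.
Qed.

Section geometric_cauchy.
Context {R : realType} {T : metricType R}.
Variable b : nat -> T.
Hypothesis b_step : forall n, mdist (b n) (b n.+1) <= 2 * (2 ^+ n)^-1.

(** The right-hand side is the exact sum of 2 * 2^-i for n <= i < n + k, which lets the induction on
    k close. *)
Let b_dist n k :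
  mdist (b n) (b (n + k)) <= 4 * (2 ^+ n)^-1 - 4 * (2 ^+ (n + k))^-1.
Proof.
elim: k => [|k ih]; first by rewrite addn0 mdistxx subrr.
rewrite addnS (le_trans (metric_triangle _ (b (n + k)) _))//.
have := lerD ih (b_step (n + k)); rewrite exprS invfM.
by move=> /le_trans; apply; lra.
Qed.

Lemma geometric_cvg : (forall F : set_system T, ProperFilter F -> cauchy F ->
    exists l : T, F --> l) ->
  exists l, forall n, mdist (b n) l <= 4 * (2 ^+ n)^-1.
Proof.
move=> complT; have [|l bl] := complT (b @ \oo) _.
  apply: cauchy_exP => eps eps0.
  have [|n n4] := @exists_half_expn_lt R (eps / 4); first by rewrite divr_gt0.
  exists (b n); exists n => //= m nm; rewrite ballEmdist/= -(subnKC nm).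
  have : 0 < (2 ^+ (n + (m - n)) : R)^-1 by rewrite invr_gt0 exprn_gt0.
  have := b_dist n (m - n); set x := mdist _ _; lra.
exists l => n; apply/ler_addgt0Pr => e e0.
have /cvg_ballP/(_ e e0) [N _ /(_ (n + N)%N)/=] := bl.
rewrite leq_addl => /(_ isT); rewrite ballEmdist/= metric_sym => lb.
rewrite (le_trans (metric_triangle _ (b (n + N)) _))//.
have : 0 < (2 ^+ (n + N) : R)^-1 by rewrite invr_gt0 exprn_gt0.
have := b_dist n N; move: lb.
by set x := mdist _ _; set y := mdist _ _; lra.
Qed.

End geometric_cauchy.

(* Points of a Polish space are coded by sequences of indices of approximating
   points of a dense sequence. The decoding [r] ignores an index that would make
   the sequence jump too far, hence is defined, and measurable, everywhere: this
   avoids any appeal to the measurability of injective images. *)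
Lemma standard_borel_retract (R : realType) d (X : measurableType d) :
  standard_borel R X -> exists (Z : X -> R) (r : R -> X),
    [/\ measurable_fun setT Z, measurable_fun setT r, cancel Z r &
        forall x, 0 <= Z x <= 1].
Proof.
move=> [T [f [polT [g fK gK] mf]]].
have [e eP] := polish_dense_sequence polT (f point).
have mfo (U : set T) : open U -> measurable (f @^-1` U).
  by move=> oU; apply/mf; exact: sub_sigma_algebra.
have [|Z [E [mZ Z01 mE ZE]]] := @marczewski_function R _ X (nat * nat)%type
  (fun nk => f @^-1` (ball (e nk.2) (2 ^+ nk.1)^-1)^°).
  by move=> [n k]; apply: mfo; exact: open_interior.
(* [a n t] is an index k for which the code t asserts that the coded point is within 2^-n of [e k],
   if there is such a k. *)
have /choice[a aP] : forall n, exists a : R -> nat, measurable_fun setT a /\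
    forall t, (exists k, E (n, k) t) -> E (n, a t) t.
  by move=> n; have [|a] := @measurable_first_index _ R (fun k => E (n, k));
    [|exists a].
pose step n i k := if mdist (e i) (e k) <= 2 * (2 ^+ n)^-1 then k else i.
pose fix idx n t {struct n} :=
  if n is m.+1 then step m (idx m t) (a n t) else a 0%N t.
have midx n : measurable_fun setT (idx n).
  elim: n => [|n ih]; first by case: (aP 0%N).
  by apply: measurable_fun_nat2 => //; case: (aP n.+1).
have /choice[l lP] : forall t, exists l,
    forall n, mdist (e (idx n t)) l <= 4 * (2 ^+ n)^-1.
  move=> t; apply: geometric_cvg (polT.1) => n /=.
  rewrite /step; case: ifPn => // _; rewrite mdistxx mulr_ge0// invr_ge0.
have ml B : <<s [set U | open U] >> B -> measurable (l @^-1` B).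
  move=> sB; rewrite -[X in measurable X]setTI; move: B sB.
  apply: smallest_sub.
    by apply: sigma_algebra_image; exact: sigma_algebra_measurable.
  move=> U oU; rewrite /image_set_system/= setTI.
  (* The limit lies within 4 * 2^-n of the nth point, hence in the ball of radius 5 * 2^-n about it.
     Conversely, if U contains the eps-ball about the limit and 9 * 2^-n < eps, it contains that
     ball, as 4 + 5 = 9. *)
  rewrite (_ : _ @^-1` _ = \bigcup_n
    (idx n @^-1` [set i | ball (e i) (5 * (2 ^+ n)^-1) `<=` U])).
    apply: bigcupT_measurable => n; rewrite -[X in measurable X]setTI.
    exact: midx.
  apply/seteqP; split=> [t Ult|t [n _]/=]; last first.
    apply; rewrite ballEmdist/=; apply: le_lt_trans (lP t n) _.
    by rewrite ltr_pM2r ?invr_gt0 ?exprn_gt0// ltr_nat.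
  have /nbhs_ballP[eps /= eps0 ballU] : nbhs (l t) U by exact: open_nbhs_nbhs.
  have [|n n9] := @exists_half_expn_lt R (eps / 9); first by rewrite divr_gt0.
  exists n => //= y; rewrite ballEmdist/= => ey; apply: ballU.
  rewrite ballEmdist/= (le_lt_trans (metric_triangle _ (e (idx n t)) _))//.
  have := lP t n; rewrite metric_sym; move: ey.
  by set u := mdist _ _; set v := mdist _ _; lra.
exists Z, (g \o l); split=> //.
  move=> _ A mA; rewrite setTI comp_preimage; apply: ml; apply/mf.
  by rewrite -comp_preimage (_ : g \o f = id)//; apply/funext => x /=.
move=> x; rewrite /= -[RHS]fK; congr g.
have aZ n : mdist (f x) (e (a n (Z x))) < (2 ^+ n)^-1.
  have EZ k : E (n, k) (Z x) = (ball (e k) (2 ^+ n)^-1)^° (f x).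
    by rewrite -[LHS]/((Z @^-1` E (n, k)) x) ZE.
  have [_ /(_ (Z x))] := aP n; rewrite EZ => /(_ _)/interior_subset.
  rewrite ballEmdist/= metric_sym; apply.
  have [|k xk] := eP (f x) (2 ^+ n)^-1; first by rewrite invr_gt0 exprn_gt0.
  exists k; rewrite EZ; apply/nbhs_ballP.
  exists ((2 ^+ n)^-1 - mdist (f x) (e k)); first by rewrite /= subr_gt0.
  move=> y; rewrite !ballEmdist/= => xy.
  apply: le_lt_trans (metric_triangle _ (f x) _) _.
  by rewrite -ltrBrDl [mdist (e k) _]metric_sym.
(* On a genuine code no jump is rejected: consecutive points are less than 2^-n + 2^-(n+1) apart,
   below the allowed 2 * 2^-n. *)
have idxZ n : mdist (f x) (e (idx n (Z x))) < (2 ^+ n)^-1.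
  elim: n => [|n ih] /=; first exact: aZ.
  rewrite /step ifT; first exact: aZ.
  apply: le_trans (metric_triangle _ (f x) _) _.
  have := aZ n.+1; rewrite exprS invfM metric_sym.
  move: ih; set u := mdist _ _; set v := mdist _ _.
  have : 0 < (2 ^+ n : R)^-1 by rewrite invr_gt0 exprn_gt0.
  by lra.
apply/esym/mdist_positivity/eqP; rewrite eq_le mdist_ge0 andbT leNgt.
apply/negP => d0.
(* Here 5 = 1 + 4: the nth point is within 2^-n of [f x] and within 4 * 2^-n of the limit. *)
have [|n n5] := @exists_half_expn_lt R (mdist (f x) (l (Z x)) / 5).
  by rewrite divr_gt0.
have := metric_triangle (f x) (e (idx n (Z x))) (l (Z x)).
have := lP (Z x) n; have := idxZ n; move: n5.
set u := mdist _ _; set v := mdist _ _; set w := mdist _ _.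
by lra.
Qed.

(** * Conditional probabilities *)

Section ae_le.
Local Open Scope ereal_scope.

(** On the set where g < f, both functions have equal integrals over every measurable subset, so
    they agree almost everywhere there and the set is null. *)
Lemma ae_le_integral d (W : measurableType d) (R : realType)
    (mu : {measure set W -> \bar R}) (f g : W -> \bar R) :
  (forall x, 0 <= f x) -> measurable_fun setT f ->
  (forall x, 0 <= g x) -> mu.-integrable setT g ->
  (forall A, measurable A ->
    \int[mu]_(x in A) f x <= \int[mu]_(x in A) g x) ->
  {ae mu, forall x, f x <= g x}.
Proof.
move=> f0 mf g0 ig fg; have mg := measurable_int _ ig.
have mD : measurable [set x | g x < f x].
  by rewrite -[X in measurable X]setTI; exact: measurable_lte.
have : ae_eq mu [set x | g x < f x] g f.
  apply: integral_ae_eq => //.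
  - exact: integrableS ig.
  - exact: measurable_funTS.
  - move=> E ED mE; apply/eqP; rewrite eq_le fg// andbT.
    apply: ge0_le_integral => //; try exact: measurable_funTS.
    by move=> x /ED/ltW.
apply: filterS => x gf; rewrite leNgt; apply/negP => gfx.
by move: (gfx); rewrite gf// ltxx.
Qed.

End ae_le.

Section conditional_probability.
Local Open Scope ereal_scope.
Context {d d' : measure_display} {X : measurableType d} {W : measurableType d'}
  {R : realType}.
Variables (p : probability X R) (w : probability W R) (pi : {mfun X >-> W}).
Hypothesis wE : forall A, measurable A -> w A = p (pi @^-1` A).

Section restricted_image.
Variables (B : set X) (mB : measurable B).

(** Its density with respect to [w] is the conditional probability of [B] given [pi]. *)
Definition restricted_image : set W -> \bar R := pushforward (mrestr p mB) pi.

Let restricted_image0 : restricted_image set0 = 0.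
Proof. by rewrite /restricted_image/pushforward preimage_set0 measure0. Qed.

Let restricted_image_ge0 A : 0 <= restricted_image A.
Proof. exact: measure_ge0. Qed.

Let restricted_image_sigma_additive : semi_sigma_additive restricted_image.
Proof. exact: measure_semi_sigma_additive. Qed.

HB.instance Definition _ := isMeasure.Build _ _ _ restricted_image
  restricted_image0 restricted_image_ge0 restricted_image_sigma_additive.

Let restricted_image_fin : fin_num_fun restricted_image.
Proof. move=> A mA; rewrite /restricted_image/pushforward fin_num_measure//.
exact: measurable_funPTI. Qed.

HB.instance Definition _ :=
  Measure_isFinite.Build _ _ _ restricted_image restricted_image_fin.

Lemma restricted_imageE A : restricted_image A = p (pi @^-1` A `&` B).
Proof. by []. Qed.

Lemma restricted_image_le A : measurable A -> restricted_image A <= w A.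
Proof.
move=> mA; rewrite restricted_imageE wE//.
have mpA : measurable (pi @^-1` A) by exact: measurable_funPTI.
by rewrite le_measure ?inE//; exact: measurableI.
Qed.

End restricted_image.

(** The Radon-Nikodym density of [restricted_image] is at most 1 almost everywhere, because that
    measure is bounded by [w]; truncating at 1 makes the bound hold everywhere without changing
    integrals. *)
Lemma conditional_probability (B : set X) : measurable B ->
  exists h : W -> R, [/\ measurable_fun setT h, forall x, (0 <= h x <= 1)%R &
    forall A, measurable A ->
      \int[w]_(x in A) (h x)%:E = p (pi @^-1` A `&` B)].
Proof.
move=> mB; have [|f [f0 fi fE]] :=
    @radon_nikodym_finite _ _ _ w (restricted_image mB).
  apply/null_content_dominatesP => A mA wA.
  by apply/eqP; rewrite eq_le measure_ge0 andbT -wA restricted_image_le.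
have mf := measurable_int _ fi.
have f1 : {ae w, forall x, f x <= 1}.
  apply: ae_le_integral => //; first exact: finite_measure_integrable_cst.
  move=> A mA; rewrite -fE// integral_cst// mul1e.
  exact: restricted_image_le.
exists (fun x => Num.min 1 (fine (f x)))%R; split.
- apply: measurable_minr => //; exact: measurableT_comp.
- by move=> x; rewrite le_min ler01 fine_ge0//= ge_min lexx.
- move=> A mA; rewrite -[RHS]restricted_imageE fE//.
  have mh : measurable_fun A (fun x => (Num.min 1 (fine (f x)))%R%:E).
    apply/measurable_EFinP/measurable_funTS.
    by apply: measurable_minr => //; exact: measurableT_comp.
  apply: ge0_ae_eq_integral => //; first exact: measurable_funTS.
    by move=> x _; rewrite lee_fin le_min ler01 fine_ge0.
  apply: filterS f1 => x; have := f0 x; case: (f x) => //= r _.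
  by rewrite lee_fin => r1 _; rewrite min_r.
Qed.

End conditional_probability.

(** * Kernels from distribution functions *)

Lemma measurable_cst_set d (T : measurableType d) (P : Prop) :
  measurable [set _ : T | P].
Proof.
have [HP|nP] := pselect P.
  by rewrite (_ : [set _ | _] = setT)//; apply/seteqP; split.
by rewrite (_ : [set _ | _] = set0)//; apply/seteqP; split.
Qed.

(* The right-continuous distribution function determined by the family of
   strict bounds "the value at [t] is less than [s]", read as [Q t s]. *)
Section rational_cdf.
Context {R : realType}.
Variable Q : rat -> rat -> Prop.

(** The element 1 and the condition 0 <= s keep the infimum in [0, 1] for every [Q]; the strict
    inequality u < t makes it right-continuous in u. *)
Let S (u : R) : set R := [set 1] `|`
  [set c | exists t s : rat, [/\ u < ratr t, 0 <= s, Q t s & c = ratr s]].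

Definition rational_cdf (u : R) : R := inf (S u).

Let S0 u : lbound (S u) 0.
Proof. by move=> _ [->//|[t [s [_ s0 _ ->]]]]; rewrite ler0q. Qed.

Let SlbS u : has_lbound (S u).
Proof. by exists 0; exact: S0. Qed.

Lemma rational_cdf_ge0 u : 0 <= rational_cdf u.
Proof. by apply: lb_le_inf; [exists 1; left|exact: S0]. Qed.

Lemma rational_cdf_le1 u : rational_cdf u <= 1.
Proof. by apply: ge_inf => //; left. Qed.

Lemma rational_cdf_le u t s :
  u < ratr t -> 0 <= s -> Q t s -> rational_cdf u <= ratr s.
Proof. by move=> ut s0 Qts; apply: ge_inf => //; right; exists t, s. Qed.

Lemma le_rational_cdf u c : c <= 1 ->
  (forall t s, u < ratr t -> 0 <= s -> Q t s -> c <= ratr s) ->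
  c <= rational_cdf u.
Proof.
move=> c1 cQ; apply: lb_le_inf; first by exists 1; left.
by move=> _ [->//|[t [s [ut s0 Qts ->]]]]; exact: cQ Qts.
Qed.

(** Reduces strict upper bounds to countably many conditions on [Q], whence measurability when [Q]
    depends on a parameter. *)
Lemma rational_cdf_ltP u c : rational_cdf u < c <->
  1 < c \/ exists t s, [/\ u < ratr t, 0 <= s, ratr s < c & Q t s].
Proof.
split=> [/inf_lt[|x [->|]]|[c1|[t [s [ut s0 sc Qts]]]]].
- by exists 1; left.
- by left.
- by move=> [t [s [ut s0 Qts ->]]] sc; right; exists t, s.
- exact: le_lt_trans (rational_cdf_le1 u) c1.
- exact: le_lt_trans (rational_cdf_le ut s0 Qts) sc.
Qed.

Let rational_cdf_nd : nondecreasing rational_cdf.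
Proof.
move=> u v uv; apply: le_rational_cdf; first exact: rational_cdf_le1.
by move=> t s vt; apply: rational_cdf_le; exact: le_lt_trans vt.
Qed.

Let rational_cdf_rc : right_continuous rational_cdf.
Proof.
move=> u; apply/cvgrPdist_lt => e e0.
(* A pair t, s that witnesses the bound at u witnesses it at every v < t. *)
have [v0 uv0 Fv0] : exists2 v0, u < v0 &
    forall v, v < v0 -> rational_cdf v < rational_cdf u + e.
  have /rational_cdf_ltP[c1|[t [s [ut s0 sc Qts]]]] :
      rational_cdf u < rational_cdf u + e by rewrite ltrDl.
    exists (u + 1) => [|v _]; first by rewrite ltrDl.
    exact: le_lt_trans (rational_cdf_le1 v) c1.
  exists (ratr t) => // v vt.
  exact: le_lt_trans (rational_cdf_le vt s0 Qts) sc.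
near=> v; have uv : u < v by near: v; exact: nbhs_right_gt.
rewrite distrC ger0_norm ?subr_ge0 ?rational_cdf_nd ?ltW//.
by rewrite ltrBlDl; apply: Fv0; near: v; exact: nbhs_right_lt.
Unshelve. all: by end_near. Qed.

HB.instance Definition _ := isCumulative.Build R _ R rational_cdf
  rational_cdf_nd rational_cdf_rc.

Hypothesis Q1 : forall t s, Q t s -> t <= 1.
Hypothesis Q0 : forall t, t < 0 -> Q t 0.

Lemma rational_cdf_ge1 u : 1 <= u -> rational_cdf u = 1.
Proof.
move=> u1; apply/eqP; rewrite eq_le rational_cdf_le1/=.
apply: le_rational_cdf => // t s ut _ /Q1 t1; exfalso.
by move: (le_lt_trans u1 ut); rewrite ltNge -(rmorph1 (@ratr R)) ler_rat t1.
Qed.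

Lemma rational_cdf_lt0 u : u < 0 -> rational_cdf u = 0.
Proof.
move=> u0; apply/eqP; rewrite eq_le rational_cdf_ge0 andbT.
have [t] := rat_in_itvoo u0; rewrite in_itv/= => /andP[ut t0].
rewrite -(rmorph0 (@ratr R)); apply: rational_cdf_le ut _ _ => //.
by apply: Q0; rewrite -(ltr_rat R) rmorph0.
Qed.

Let rational_cdfNy : rational_cdf @ -oo --> (0 : R).
Proof.
apply: cvg_near_cst; near=> u; apply: rational_cdf_lt0.
by near: u; exact: nbhs_ninfty_lt.
Unshelve. all: by end_near. Qed.

Let rational_cdfy : rational_cdf @ +oo --> (1 : R).
Proof.
apply: cvg_near_cst; near=> u; apply: rational_cdf_ge1.
by near: u; exact: nbhs_pinfty_ge.
Unshelve. all: by end_near. Qed.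

Lemma rational_cdf_probability : exists P : probability R R,
  forall u, P `]-oo, u]%classic = (rational_cdf u)%:E.
Proof.
pose F : cumulativeBounded (0 : R) (1 : R) := HB.pack rational_cdf
  (isCumulativeBounded.Build R 0 1 rational_cdf rational_cdfNy rational_cdfy).
(* The identity carries the Stieltjes measure from [measurableTypeR R] over to [R]. *)
pose idR : {mfun measurableTypeR R >-> R} :=
  HB.pack (idfun : measurableTypeR R -> R) (@isMeasurableFun.Build
    _ _ (measurableTypeR R) R _ (@measurable_id _ _ setT)).
exists (distribution (lebesgue_stieltjes_measure F) idR) => u.
exact: (cdf_lebesgue_stieltjes_id F u).
Qed.

End rational_cdf.

Lemma measurable_rational_cdf (R : realType) d (Y : measurableType d)
    (Q : Y -> rat -> rat -> Prop) (u : R) :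
  (forall t s, measurable [set y | Q y t s]) ->
  measurable_fun setT (fun y => rational_cdf (Q y) u : R).
Proof.
move=> mQ; apply: (measurability _ (RGenInftyO.measurableE R)).
move=> _ [_ [c ->] <-]; rewrite setTI.
rewrite (_ : _ @^-1` _ = [set _ | 1 < c] `|` \bigcup_t \bigcup_s
    ([set _ | [/\ u < ratr t, 0 <= s & ratr s < c]] `&` [set y | Q y t s])).
  apply: measurableU; first exact: measurable_cst_set.
  apply: bigcupT_measurable_rat => t; apply: bigcupT_measurable_rat => s.
  by apply: measurableI => //; exact: measurable_cst_set.
apply/seteqP; split=> y; rewrite /= in_itv/=.
  move=> /rational_cdf_ltP[c1|[t [s [ut s0 sc Qts]]]]; [by left|right].
  by exists t => //; exists s.
move=> [c1|[t _ [s _ [[ut s0 sc] Qts]]]]; apply/rational_cdf_ltP; first by left.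
by right; exists t, s.
Qed.

(** With [rays_setI_closed], the rays form a generating pi-system, so kernels and finite measures on
    the line can be handled through distribution functions. *)
Lemma rays_measurableE (R : realType) :
  @measurable _ R = <<s [set A : set R | exists u, A = `]-oo, u]%classic] >>.
Proof.
apply/seteqP; split; last first.
  apply: smallest_sub; first exact: sigma_algebra_measurable.
  by move=> _ [u ->]; exact: measurable_itv.
rewrite (_ : measurable = <<s @RGenOInfty.G R >>); last first.
  exact: RGenOInfty.measurableE.
apply: smallest_sub; first exact: smallest_sigma_algebra.
move=> _ [u ->]; rewrite -setCitvl -setTD.
have [_ + _] := smallest_sigma_algebra setT
  [set A : set R | exists u, A = `]-oo, u]%classic].
by apply; apply: sub_sigma_algebra; exists u.
Qed.

Lemma rays_setI_closed (R : realType) :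
  setI_closed [set A : set R | exists u, A = `]-oo, u]%classic].
Proof.
move=> _ _ [u ->] [v ->]; exists (Num.min u v).
by apply/seteqP; split=> x /=; rewrite !in_itv/= le_min => /andP.
Qed.

Section kernel_of_family.
Local Open Scope ereal_scope.

Section family_kernel.
Context {d d' : measure_display} {W : measurableType d} {Y : measurableType d'}
  {R : realType}.
Variable P : W -> probability Y R.
Hypothesis mP : forall A, measurable A -> measurable_fun setT (fun w => P w A).

Let family : W -> {measure set Y -> \bar R} := P.

HB.instance Definition _ := isKernel.Build _ _ _ _ _ family mP.

HB.instance Definition _ := Kernel_isProbability.Build _ _ _ _ _ family
  (fun w => probability_setT (P w)).

Definition family_kernel : R.-pker W ~> Y := family.

End family_kernel.

(** The sets A for which [P w A] is measurable in w form a Dynkin system containing the pi-system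
    [G]. *)
Lemma pker_of_family d d' (W : measurableType d) (Y : measurableType d')
    (R : realType) (G : set (set Y)) (P : W -> probability Y R) :
  @measurable _ Y = <<s G >> -> setI_closed G ->
  (forall A, G A -> measurable_fun setT (fun w => P w A)) ->
  exists k : R.-pker W ~> Y, forall w, k w = P w :> (set Y -> \bar R).
Proof.
move=> GE GI GP.
have mP A : measurable A -> measurable_fun setT (fun w => P w A).
  rewrite {1}GE; move: A.
  apply: (dynkin_induction GE GI).
  - rewrite (_ : (fun _ => _) = cst 1)//.
    by apply/funext => w; rewrite probability_setT.
  - exact: GP.
  - move=> A mA mPA; under eq_fun do rewrite probability_setC//.
    exact: emeasurable_funB.
  - move=> F mF tF mPF.
    rewrite (_ : (fun _ => _) = (fun w => \sum_(0 <= n <oo) P w (F n))).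
      exact: ge0_emeasurable_sum.
    apply/funext => w; rewrite measure_semi_bigcup//.
    exact: bigcupT_measurable.
by exists (family_kernel mP).
Qed.

End kernel_of_family.

(** * Conditional laws *)

Section conditional_cdf.
Local Open Scope ereal_scope.
Context {d d' : measure_display} {X : measurableType d} {W : measurableType d'}
  {R : realType}.
Variables (p : probability X R) (w : probability W R) (pi : {mfun X >-> W}).
Hypothesis wE : forall A, measurable A -> w A = p (pi @^-1` A).
Variable Z : {mfun X >-> R}.
Hypothesis Z01 : forall x, (0 <= Z x <= 1)%R.
Variable h : R -> W -> R.
Hypothesis mh : forall u, measurable_fun setT (h u).
Hypothesis h01 : forall u x, (0 <= h u x <= 1)%R.
Hypothesis hE : forall u A, measurable A ->
  \int[w]_(x in A) (h u x)%:E = p (pi @^-1` A `&` Z @^-1` `]-oo, u]).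

(* The clauses on the sign of [t] and on [t <= 1] fix the limits at infinity of
   the resulting distribution function. Once [h] is coded by a real variable,
   they make it a distribution function even at reals that code no point. *)
Definition conditional_bound (x : W) (t s : rat) : Prop :=
  (t <= 1)%R /\ ((t < 0)%R \/ (h (ratr t) x < ratr s)%R).

Let F u x : R := rational_cdf (conditional_bound x) u.

Let mZ u : measurable (Z @^-1` `]-oo, u]).
Proof. by apply: measurable_funPTI; exact: measurable_itv. Qed.

Let mpi A : measurable A -> measurable (pi @^-1` A).
Proof. exact: measurable_funPTI. Qed.

(** For each rational t the comparison of integrals gives the inequality almost surely; as the
    rationals are countable, one null set serves them all. *)
Let h_ae_nd u : {ae w, forall x, forall t : rat, (u < ratr t)%R ->
  (h u x <= h (ratr t) x)%R}.
Proof.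
have : {ae w, forall x, forall n, if unpickle n is Some t then
    ((u < ratr (t : rat))%R -> (h u x <= h (ratr t) x)%R) else True}.
  apply/ae_foralln => n; case: (unpickle n) => [t|]; last exact: aeW.
  have [ut|_] := boolP (u < ratr t)%R; last exact: aeW.
  have : {ae w, forall x, (h u x)%:E <= (h (ratr t) x)%:E}.
    apply: ae_le_integral => [x||x||A mA].
    - by rewrite lee_fin; case/andP: (h01 u x).
    - exact/measurable_EFinP.
    - by rewrite lee_fin; case/andP: (h01 (ratr t) x).
    - have := finite_measure_integrable_cst w 1%R measurableT.
      apply: le_integrable => //; first exact/measurable_EFinP.
      move=> x _ /=; have /andP[h0 h1] := h01 (ratr t) x.
      by rewrite lee_fin normr1 ger0_norm.
    - rewrite !hE// le_measure ?inE//;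
        try by apply: measurableI => //; exact: mpi.
      apply: setIS => x /=; rewrite !in_itv/= => /le_trans; apply.
      exact: ltW.
  by apply: filterS => x; rewrite lee_fin.
by apply: filterS => x hx t; have := hx (pickle t); rewrite pickleK.
Qed.

Let F_ge0 u x : 0 <= (F u x)%:E.
Proof. by rewrite lee_fin rational_cdf_ge0. Qed.

Let mF u A : measurable A -> measurable_fun A (fun x => (F u x)%:E).
Proof.
move=> mA; apply/measurable_EFinP/measurable_funTS.
apply: measurable_rational_cdf => t s.
apply: measurableI; first exact: measurable_cst_set.
apply: measurableU; first exact: measurable_cst_set.
have := mh (ratr t) measurableT (measurable_itv `]-oo, ratr s[).
by rewrite setTI; congr measurable; apply/seteqP; split=> x /=; rewrite in_itv.
Qed.

Let F_le u x (t : rat) : (u < ratr t)%R -> (t <= 1)%R ->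
  (F u x <= h (ratr t) x)%R.
Proof.
move=> ut t1; apply/ler_addgt0Pr => e e0.
have /rat_in_itvoo[s] : (h (ratr t) x < h (ratr t) x + e)%R by rewrite ltrDl.
rewrite in_itv/= => /andP[hs se]; apply: le_trans (ltW se).
apply: rational_cdf_le ut _ _; last by split=> //; right.
rewrite -(ler0q R) ltW// (le_lt_trans _ hs)//.
by case/andP: (h01 (ratr t) x).
Qed.

Let integral_F_le u (t : rat) A : measurable A -> (u < ratr t)%R ->
  \int[w]_(x in A) (F u x)%:E <= p (pi @^-1` A `&` Z @^-1` `]-oo, ratr t]).
Proof.
move=> mA ut; have [t1|t1] := leP t 1%R.
  rewrite -hE//; apply: ge0_le_integral => [//|//|||].
  - exact: mF.
  - by apply/measurable_EFinP; exact: measurable_funTS.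
  - by move=> x _; rewrite lee_fin; exact: F_le.
rewrite (_ : Z @^-1` _ = setT) ?setIT; last first.
  apply/seteqP; split=> // x _ /=; rewrite in_itv/=.
  have /andP[_ Z1] := Z01 x; apply: le_trans Z1 _.
  by rewrite -(rmorph1 (@ratr R)) ler_rat ltW.
rewrite -wE//; apply: (@le_trans _ _ (\int[w]_(x in A) 1)); last first.
  by rewrite integral_cst// mul1e.
apply: ge0_le_integral => [//|//|||].
- exact: mF.
- exact: measurable_cst.
- by move=> x _; rewrite lee_fin rational_cdf_le1.
Qed.

(** For u < 0 both sides vanish. Otherwise [h u] is almost surely a lower bound of the admissible
    values, which gives one inequality; the other follows by letting rational t decrease to u. *)
Lemma integral_conditional_cdf u A : measurable A ->
  \int[w]_(x in A) (rational_cdf (conditional_bound x) u)%:E =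
  p (pi @^-1` A `&` Z @^-1` `]-oo, u]).
Proof.
move=> mA; have [u0|u0] := ltP u 0%R.
  rewrite (_ : Z @^-1` _ = set0) ?setI0 ?measure0; last first.
    apply/seteqP; split=> // x /=; rewrite in_itv/= => Zu.
    by have /andP[+ _] := Z01 x; rewrite leNgt (le_lt_trans Zu).
  apply: integral0_eq => x _; rewrite rational_cdf_lt0//.
  by move=> t t0; split; [rewrite ltW// (lt_trans t0)|left].
apply/eqP; rewrite eq_le; apply/andP; split; last first.
  rewrite -hE//; apply: ae_ge0_le_integral => [//|||x _||].
  - by move=> x _; rewrite lee_fin; case/andP: (h01 u x).
  - by apply/measurable_EFinP; exact: measurable_funTS.
  - exact: F_ge0.
  - exact: mF.
  - apply: filterS (h_ae_nd u) => x hx _; rewrite lee_fin.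
    apply: le_rational_cdf; first by case/andP: (h01 u x).
    move=> t s ut s0 [_ [t0|hs]]; last exact: le_trans (hx _ ut) (ltW hs).
    have := le_lt_trans u0 ut; rewrite ltr0q => /(lt_trans t0).
    by rewrite ltxx.
(* Between u and u + 1/(n+1) there is a rational t, so the integral is at most p ([G n]); continuity
   of p from above concludes. *)
pose G n := pi @^-1` A `&` Z @^-1` `]-oo, (u + n.+1%:R^-1)%R].
have mG n : measurable (G n) by apply: measurableI => //; exact: mpi.
have -> : pi @^-1` A `&` Z @^-1` `]-oo, u] = \bigcap_n G n.
  apply/seteqP; split=> [x [Ax /=]|x Gx].
    rewrite in_itv/= => Zu n _; split=> //=.
    by rewrite in_itv/= (le_trans Zu)// lerDl.
  split; first by case: (Gx 0%N Logic.I).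
  rewrite /= in_itv/=; apply/ler_addgt0Pr => e e0.
  have [n _ /(_ n (leqnn n)) ne] := near_infty_natSinv_lt (PosNum e0).
  have [_ /=] := Gx n Logic.I; rewrite in_itv/= => /le_trans; apply.
  by rewrite lerD2l ltW.
apply: (cvge_to_ge (@nonincreasing_cvg_mu _ _ _ p G _ mG _ _)).
- by rewrite (le_lt_trans (probability_le1 _ _))// ltry.
- exact: bigcapT_measurable.
- move=> n m nm; apply/subsetPset; apply: setIS => x /=; rewrite !in_itv/=.
  by move=> /le_trans; apply; rewrite lerD2l lef_pV2 ?posrE// ler_nat.
apply: nearW => n /=.
have /rat_in_itvoo[t] : (u < u + n.+1%:R^-1)%R by rewrite ltrDl.
rewrite in_itv/= => /andP[ut tn]; apply: le_trans (integral_F_le mA ut) _.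
rewrite le_measure ?inE//; first by apply: measurableI => //; exact: mpi.
apply: setIS => x /=; rewrite !in_itv/= => /le_trans; apply.
exact: ltW.
Qed.

End conditional_cdf.

Lemma conditional_law d d' (X : measurableType d) (W : measurableType d')
    (R : realType) (p : probability X R) (w : probability W R)
    (pi : {mfun X >-> W}) (Z : {mfun X >-> R}) :
  (forall A, measurable A -> w A = p (pi @^-1` A)) ->
  (forall x, 0 <= Z x <= 1) ->
  exists (phi : {mfun W >-> R}) (k : R.-pker R ~> R), forall A B,
    measurable A -> measurable B ->
    (\int[w]_(x in A) k (phi x) B = p (pi @^-1` A `&` Z @^-1` B))%E.
Proof.
move=> wE Z01.
have mZ u : measurable (Z @^-1` `]-oo, u]).
  by apply: measurable_funPTI; exact: measurable_itv.
have [h hP] := choice (fun u => conditional_probability wE (mZ u)).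
have mh u : measurable_fun setT (h u) by case: (hP u).
have h01 u x : 0 <= h u x <= 1 by case: (hP u).
have hE u : forall A, measurable A ->
  (\int[w]_(x in A) (h u x)%:E = p (pi @^-1` A `&` Z @^-1` `]-oo, u]))%E.
  by case: (hP u).
have [|phi [E [mphi _ mE phiE]]] := @marczewski_function R _ W (rat * rat)%type
  (fun ts => h (ratr ts.1) @^-1` `]-oo, ratr ts.2[).
  by move=> [t s]; rewrite -[X in measurable X]setTI; exact: mh.
(* Reading the comparisons of [h] off the coding sets [E] makes the bounds meaningful at every real
   y; at y = [phi x] they are those of [conditional_bound h x]. *)
pose Q y (t s : rat) := t <= 1 /\ (t < 0 \/ E (t, s) y).
have QE x : Q (phi x) = conditional_bound h x.
  apply/funext => t; apply/funext => s; rewrite /Q /conditional_bound.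
  rewrite (_ : E (t, s) (phi x) = (h (ratr t) x < ratr s))//.
  by rewrite -[LHS]/((phi @^-1` E (t, s)) x) phiE/= in_itv.
have /choice[P PE] : forall y, exists P : probability R R,
    forall u, P `]-oo, u]%classic = (rational_cdf (Q y) u)%:E.
  move=> y; apply: rational_cdf_probability; first by move=> t s [].
  by move=> t t0; split; [rewrite ltW// (lt_trans t0)|left].
have [|k kE] :=
  pker_of_family (rays_measurableE R) (@rays_setI_closed R) (P := P).
  move=> _ [u ->]; under eq_fun do rewrite PE.
  apply/measurable_EFinP; apply: measurable_rational_cdf => t s.
  apply: measurableI; first exact: measurable_cst_set.
  by apply: measurableU => //; exact: measurable_cst_set.
pose phim : {mfun W >-> R} :=
  HB.pack phi (isMeasurableFun.Build _ _ _ _ phi mphi).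
exists phim, k => A B mA mB.
pose k' : R.-pker W ~> R := kernel_comp k (kdirac mphi).
have k'E x C : measurable C -> k' x C = k (phi x) C.
  by move=> mC; rewrite kernel_compE integral_dirac ?diracT ?mul1e//;
    exact: measurable_kernel.
(* For fixed A both sides are finite measures in B, so agreement on rays suffices. The right-hand
   one is a [restricted_image] along [Z], with the preimage of A as restricting set. *)
have [mu [muE _]] := integral_disintegration w k' mA.
have mpA : measurable (pi @^-1` A) by exact: measurable_funPTI.
transitivity (mu B).
  by rewrite muE//; apply: eq_integral => x _; rewrite k'E.
rewrite setIC -(restricted_imageE p Z mpA).
apply: (@measure_unique _ R R _ (fun n => `]-oo, n%:R]%classic)
  (rays_measurableE R) (@rays_setI_closed R)
  _ _ mu (restricted_image p Z mpA)) => //.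
- by move=> n; exists n%:R.
- by rewrite -subTset => x _; exists (Num.truncn x).+1 => //=;
    rewrite in_itv/= ltW// truncnS_gt.
- move=> _ [u ->]; rewrite muE// [RHS]restricted_imageE setIC.
  rewrite -(integral_conditional_cdf wE Z01 mh h01 hE)//.
  apply: eq_integral => x _; rewrite k'E; last exact: measurable_itv.
  by rewrite kE PE QE.
- move=> n; rewrite muE; last exact: measurable_itv.
  rewrite (@le_lt_trans _ _ (\int[w]_(x in A) cst 1 x)%E)//.
    apply: ge0_le_integral => [//|//|||].
    + by apply: measurable_pker => //; exact: measurable_itv.
    + exact: measurable_cst.
    + move=> x _ /=; rewrite -(prob_kernel (s := k') x).
      by rewrite le_measure ?inE//; exact: measurable_itv.
  rewrite integral_cst// mul1e (le_lt_trans (probability_le1 _ _))//.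
  exact: ltry.
Qed.

(** * The isomorphism *)

Lemma standard_borel_real (R : realType) : standard_borel R R.
Proof.
exists R^o, idfun; split.
- split=> [F FF cF|]; first by exists (lim F); exact: (@cauchy_cvg R).
  exists (ratr @` setT); last exact: dense_rat.
  exact: sub_countable (card_image_le _ _) (countableP _).
- by exists id.
- move=> B; rewrite preimage_id; split.
    rewrite (_ : measurable = <<s @RGenOpens.G R >>); last first.
      exact: RGenOpens.measurableE.
    apply: smallest_sub; first exact: smallest_sigma_algebra.
    by move=> _ [x [y ->]]; apply: sub_sigma_algebra; exact: interval_open.
  apply: smallest_sub; first exact: sigma_algebra_measurable.
  by move=> U; exact: open_measurable.
Qed.

Section real_model.
Local Open Scope quotient_scope.
Local Open Scope ereal_scope.
Context {d : measure_display} {W : measurableType d} {R : realType}.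
Variables (w : probability W R) (phi : {mfun W >-> R}) (g : R.-pker R ~> W).
Hypothesis gE : forall A B, measurable A -> measurable B ->
  \int[w]_(x in A) g (phi x) B = w (A `&` B).

Let q : probability R R := distribution w phi.
Let f : R.-pker W ~> R := kdirac (measurable_funPT phi).

Let compgf x B : measurable B -> kernel_comp g f x B = g (phi x) B.
Proof.
move=> mB; rewrite kernel_compE integral_dirac ?diracT ?mul1e//.
exact: measurable_kernel.
Qed.

Let compfg y B : measurable B -> kernel_comp f g y B = g y (phi @^-1` B).
Proof.
move=> mB; have mpB : measurable (phi @^-1` B) by exact: measurable_funPTI.
rewrite kernel_compE (eq_integral (fun x => (\1_(phi @^-1` B) x)%:E)).
  by rewrite integral_indic// setIT.
by move=> x _; rewrite /f /kdirac/= diracE.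
Qed.

Let integral_q (v : R -> \bar R) A : measurable A -> measurable_fun A v ->
  (forall y, 0 <= v y) ->
  \int[q]_(y in A) v y = \int[w]_(x in phi @^-1` A) v (phi x).
Proof. by move=> mA mv v0; rewrite ge0_integral_pushforward. Qed.

Let preserves_f : preserves w q f.
Proof.
move=> B mB; have mpB : measurable (phi @^-1` B) by exact: measurable_funPTI.
rewrite (eq_integral (fun x => (\1_(phi @^-1` B) x)%:E)).
  by rewrite integral_indic// setIT.
by move=> x _; rewrite /f /kdirac/= diracE.
Qed.

Let preserves_g : preserves q w g.
Proof.
move=> B mB; rewrite integral_q//; last exact: measurable_kernel.
by rewrite preimage_setT gE// setTI.
Qed.

Lemma isomorphic_to_real_model : PSisomorphic w q.
Proof.
exists (\pi_(PShom w q) (PreservingKernel f preserves_f)).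
exists (\pi_(PShom q w) (PreservingKernel g preserves_g)).
rewrite !PScomp_pi; split; apply/PShom_eqP => A B mA mB /=.
  transitivity (\int[w]_(x in A) (\1_B x)%:E).
    rewrite integral_indic// [RHS](_ : _ = w (A `&` B)); last by rewrite setIC.
    by rewrite -gE//; apply: eq_integral => x _; exact: compgf.
  by apply: eq_integral => x _; rewrite /kernel_id/= /kdirac/= diracE.
have mpA : measurable (phi @^-1` A) by exact: measurable_funPTI.
have mpB : measurable (phi @^-1` B) by exact: measurable_funPTI.
transitivity (\int[q]_(x in A) (\1_B x)%:E).
  rewrite integral_indic//.
  transitivity (\int[q]_(y in A) g y (phi @^-1` B)).
    by apply: eq_integral => y _; exact: compfg.
  rewrite integral_q//; last exact: measurable_pker.
  by rewrite gE// setIC.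
by apply: eq_integral => x _; rewrite /kernel_id/= /kdirac/= diracE.
Qed.

End real_model.

Lemma quotient_standard_borel d d' (X : measurableType d)
    (W : measurableType d') (R : realType) (p : probability X R) (w : probability W R)
    (pi : {mfun X >-> W}) :
  (forall A, measurable A -> w A = p (pi @^-1` A)) -> standard_borel R X ->
  exists q : probability R R, PSisomorphic w q.
Proof.
move=> wE /standard_borel_retract[Z [r [mZ mr ZK Z01]]].
pose Zm : {mfun X >-> R} := HB.pack Z (isMeasurableFun.Build _ _ _ _ Z mZ).
have [phi [k kE]] := @conditional_law _ _ X W R p w pi Zm wE Z01.
have mpir : measurable_fun setT (pi \o r) by exact: measurableT_comp.
exists (distribution w phi).
apply: (@isomorphic_to_real_model _ W R w phi (kernel_comp (kdirac mpir) k)).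
move=> A B mA mB.
have mpB : measurable (pi @^-1` B) by exact: measurable_funPTI.
have mrB : measurable ((pi \o r) @^-1` B).
  by rewrite -[X in measurable X]setTI; exact: mpir.
transitivity (\int[w]_(x in A) k (phi x) ((pi \o r) @^-1` B))%E.
  apply: eq_integral => x _; rewrite kernel_compE.
  rewrite (eq_integral (fun y => (\1_((pi \o r) @^-1` B) y)%:E)).
    by rewrite integral_indic// setIT.
  by move=> y _; rewrite /kdirac/= diracE.
rewrite kE// wE; last exact: measurableI.
congr (p _); rewrite preimage_setI; congr (_ `&` _).
by apply/seteqP; split=> x /=; rewrite ZK.
Qed.

Theorem corollary3p17 (R : realType) (M : monoidType) (d : measure_display)
    (X : measurableType d) (p : probability X R) (D : dynamical_system M p) :
  standard_borel R X ->
  exists (d' : measure_display) (Y : measurableType d') (q : probability Y R),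
    standard_borel R Y /\ PSisomorphic (p_inv D) q.
Proof.
move=> sX.
(* Almost surely invariant sets are measurable in [X], so the identity is a measurable quotient map,
   and it sends [p] to [p_inv D]. *)
pose forget : X -> X_inv D := id.
have mforget : measurable_fun setT forget.
  by move=> _ A mA; rewrite setTI; exact: (X_inv_sub_measurable mA).
pose pi : {mfun X >-> X_inv D} :=
  HB.pack forget (isMeasurableFun.Build _ _ _ _ forget mforget).
have [|q iso] := @quotient_standard_borel _ _ X (X_inv D) R p (p_inv D) pi _ sX.
  by [].
exists _, _, q; split; first exact: standard_borel_real.
exact: iso.
Qed.
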